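(* For every integer $k\ge 0$, $\rho(H_k)\ge \lfloor 3^k/2\rfloor$.
   Context: All tournaments are finite. A tournament is a complete oriented graph: a digraph $T$ with vertex set $V(T)$ and arc set $A(T)$ (no loops) such that for all distinct $u,v\in V(T)$ exactly one of $uv$, $vu$ belongs to $A(T)$. $Aut(T)$ denotes the automorphism group of $T$; the identity is the trivial automorphism. The tournaments $H_k$ ($k\ge 0$) are defined inductively. $H_0$ is the tournament with a single vertex. For $k>0$, $H_k$ is obtained from three vertex-disjoint copies $T_1,T_2,T_3$ of $H_{k-1}$ (called the tertians of $H_k$) by adding all arcs from vertices of $T_1$ to vertices of $T_2$, all arcs from vertices of $T_2$ to vertices of $T_3$, and all arcs from vertices of $T_3$ to vertices of $T_1$. Thus $|V(H_k)|=3^k$. A vertex labeling of $T$ with two labels is a total function $\phi:V(T)\to L$ with $|L|=2$ (not required to be surjective, so a label class may be empty). An automorphism $\sigma\in Aut(T)$ preserves $\phi$ if $\phi(\sigma(v))=\phi(v)$ for all $v\in V(T)$. The labeling $\phi$ is 2-distinguishing if no nontrivial automorphism preserves it. A distinguishing vertex class is one of the two sets of vertices having the same label under a 2-distinguishing vertex labeling. $\rho(T)$ denotes the minimum size of a distinguishing vertex class of $T$, over all 2-distinguishing vertex labelings of $T$. (It is known that every finite tournament has a 2-distinguishing vertex labeling, so $\rho(T)$ is defined.) *)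

(* Defs.v *)
From mathcomp Require Import all_boot all_fingroup.

Set Implicit Arguments.
Unset Strict Implicit.
Unset Printing Implicit Defensive.

Record tournament := Tournament {
  vertex :> finType;
  arc : rel vertex;
  arc_irr : irreflexive arc;
  arc_total : forall u v : vertex, u != v -> arc u v (+) arc v u
}.

Section Distinguishing.

Variable T : tournament.

Definition automorphisms : {set {perm T}} :=
  [set s : {perm T} | [forall u, forall v, arc (s u) (s v) == arc u v]].

Definition preserves (s : {perm T}) (phi : {ffun T -> bool}) : bool :=
  [forall v, phi (s v) == phi v].

Definition distinguishing (phi : {ffun T -> bool}) : bool :=
  [forall s in automorphisms, preserves s phi ==> (s == 1%g)].

Definition distinguishing_class (A : {set T}) : bool :=
  [exists phi : {ffun T -> bool}, exists b : bool,
    distinguishing phi && (A == [set v | phi v == b])].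

(* If T had no distinguishing class, the arg min would return its default    *)
(* set0, so the junk value of rho is 0 and a positive lower bound on rho T    *)
(* entails that a distinguishing class exists.                                *)
Definition rho : nat :=
  #|[arg min_(A < set0 | distinguishing_class A) #|A|]|.

Lemma rho_min (A0 : {set T}) : distinguishing_class A0 ->
  (exists2 A, distinguishing_class A & #|A| = rho) /\
  (forall A, distinguishing_class A -> rho <= #|A|).
Proof.
move=> dA0; rewrite /rho /arg_min /extremum.
case: pickP => [A /andP[dA /forall_inP minA] | noA].
  by split; [exists A | move=> B dB; apply: minA].
have [B dB minB] := @arg_minnP _ A0 distinguishing_class (fun A => #|A|) dA0.
by have /negP[] := negbT (noA B); apply/andP; split=> //; apply/forall_inP.
Qed.

End Distinguishing.

Definition arc1 : rel unit := fun _ _ => false.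

Lemma arc1_irr : irreflexive arc1.
Proof. by []. Qed.

Lemma arc1_total (u v : unit) : u != v -> arc1 u v (+) arc1 v u.
Proof. by case: u v => [] []. Qed.

Definition point : tournament := Tournament arc1_irr arc1_total.

Section Triangle.

Variable T : tournament.

(* The i-th copy of T is [set p | p.1 == i]; ordS is the cyclic successor.   *)
Definition arc3 : rel ('I_3 * T)%type := fun p q =>
  if p.1 == q.1 then arc p.2 q.2 else q.1 == ordS p.1.

Lemma arc3_irr : irreflexive arc3.
Proof. by move=> p; rewrite /arc3 eqxx arc_irr. Qed.

Lemma arc3_total (p q : 'I_3 * T) : p != q -> arc3 p q (+) arc3 q p.
Proof.
case: p q => [i u] [j v]; rewrite /arc3 xpair_eqE /= (eq_sym j i).
have [_ | ] := eqVneq i j; first exact: arc_total.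
by case: i j => [[|[|[|i]]] lti] // [[|[|[|j]]] ltj].
Qed.

Definition triangle : tournament := Tournament arc3_irr arc3_total.

End Triangle.

Fixpoint H (k : nat) : tournament :=
  if k is k'.+1 then triangle (H k') else point.

Lemma card_H k : #|H k| = 3 ^ k.
Proof.
by elim: k => [|k IHk] /=; rewrite ?card_unit // card_prod card_ord IHk expnS.
Qed.

(* Main.v *)
Require Import Defs.
From mathcomp Require Import all_boot all_fingroup zify.
Import Defs.

Set Implicit Arguments.
Unset Strict Implicit.
Unset Printing Implicit Defensive.

(** Write 3 ^ k = 2 m + 1. Two facts are proved together by induction on [k],
    as the predicate [two_weights]: in a distinguishing labeling of [H k] the
    number of vertices labeled [true] is [m] or [m + 1], and it determines the
    labeling up to automorphism.

    A distinguishing labeling of a triangle of copies of [T] restricts to a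
    distinguishing labeling of each copy, because an automorphism of one copy
    extends by the identity. If the three restrictions had the same weight,
    they would be isomorphic by induction, and rotating the copies along these
    isomorphisms would give a nontrivial automorphism that preserves the
    labeling. So among the three weights both [m] and [m + 1] occur, and the
    total is [3 m + 1] or [3 m + 2] ([triangle_two_weights]). The total says
    how many copies have weight [m + 1]; two placements of one or two such
    copies on a cyclic triangle differ by a rotation ([bool3_rotation]), which
    again lifts to an automorphism. Uniqueness is thus what carries the bound
    from one level to the next. Both label classes then have at least [m]
    elements.

    As [rho] is 0 for a tournament without distinguishing labelings, one has to
    be exhibited on [H k]. Starting from a distinguishing labeling of [T], label
    two copies with it and the third with its complement. Automorphisms permute
    the copies ([automorphism_tertian]), and since [T] has odd order the weight
    of a labeling differs from that of its complement, so an automorphism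
    preserving the labels fixes every copy, hence is trivial
    ([triangle_distinguishing]). *)

(** * Labelings up to isomorphism *)

Section Labelings.

Variable T : tournament.
Implicit Types (s : {perm T}) (phi psi : {ffun T -> bool}).

Lemma automorphismsP s :
  reflect (forall u v, arc (s u) (s v) = arc u v) (s \in automorphisms T).
Proof.
rewrite inE; apply: (iffP 'forall_forallP) => sP u v; first exact/eqP.
by rewrite sP.
Qed.

Lemma distinguishingP phi :
  reflect (forall s, s \in automorphisms T ->
             (forall v, phi (s v) = phi v) -> s = 1%g)
          (distinguishing phi).
Proof.
apply: (iffP forall_inP) => phiP s sA.
  move=> sphi; apply/eqP; apply: (implyP (phiP s sA)).
  by apply/forallP => v; rewrite sphi.
apply/implyP => /forallP sphi; apply/eqP/phiP => // v; exact/eqP.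
Qed.

Definition isomorphic_labelings phi psi : Prop :=
  exists2 s, s \in automorphisms T & forall v, psi (s v) = phi v.

Definition weight phi : nat := #|[set v | phi v]|.

Lemma weight_sum phi : weight phi = \sum_v phi v.
Proof.
by rewrite /weight -sum1dep_card big_mkcond; apply: eq_bigr => v _; case: ifP.
Qed.

Lemma card_label phi b :
  #|[set v | phi v == b]| = if b then weight phi else #|T| - weight phi.
Proof.
rewrite /weight; case: b; first by apply: eq_card => v; rewrite !inE eqb_id.
by rewrite -(cardsC [set v | phi v]) addKn; apply: eq_card => v;
   rewrite !inE eqbF_neg.
Qed.

(** The distinguishing labelings are exhausted, up to isomorphism, by at most
    one of weight [m] and at most one of weight [m.+1]. *)
Definition two_weights (m : nat) : Prop :=
  (forall phi, distinguishing phi -> weight phi = m \/ weight phi = m.+1) /\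
  (forall phi psi, distinguishing phi -> distinguishing psi ->
     weight phi = weight psi -> isomorphic_labelings phi psi).

End Labelings.

Lemma point_two_weights : two_weights point 0.
Proof.
have w (phi : {ffun point -> bool}) : weight phi = phi tt.
  rewrite /weight; case E: (phi tt).
    by rewrite (_ : [set v | phi v] = [set tt]) ?cards1 //; apply/setP=> -[]; rewrite !inE E.
  by rewrite (_ : [set v | phi v] = set0) ?cards0 //; apply/setP=> -[]; rewrite !inE E.
split=> [phi _|phi psi _ _]; rewrite !w; first by case: (phi tt); [right | left].
move=> eq_w; exists 1%g; first by apply/automorphismsP => u v; rewrite !perm1.
by case; rewrite perm1; case: (phi tt) (psi tt) eq_w => [] [].
Qed.

(** * The cyclic triangle *)

Lemma ord3_ind (P : 'I_3 -> Prop) :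
  P ord0 -> P (ordS ord0) -> P (ordS (ordS ord0)) -> forall i, P i.
Proof.
move=> P0 P1 P2 [[|[|[|i]]] lti] //.
- by rewrite (_ : Ordinal lti = ord0) //; apply: val_inj.
- by rewrite (_ : Ordinal lti = ordS ord0) //; apply: val_inj.
by rewrite (_ : Ordinal lti = ordS (ordS ord0)) //; apply: val_inj.
Qed.

Lemma ordS3 : ordS (ordS (ordS ord0)) = ord0 :> 'I_3.
Proof. exact: val_inj. Qed.

(** Two subsets of the cyclic triangle with the same cardinality differ by a
    rotation: empty and full sets are invariant, rotations are transitive on
    singletons, and the remaining subsets are complements of singletons. *)
Lemma bool3_rotation (h h' : 'I_3 -> bool) :
    h ord0 + h (ordS ord0) + h (ordS (ordS ord0))
      = h' ord0 + h' (ordS ord0) + h' (ordS (ordS ord0)) ->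
  exists n, forall i, h i = h' (iter n (@ordS 3) i).
Proof.
move=> eq_h.
suff: [\/ [/\ h ord0 = h' ord0, h (ordS ord0) = h' (ordS ord0)
          & h (ordS (ordS ord0)) = h' (ordS (ordS ord0))],
     [/\ h ord0 = h' (ordS ord0), h (ordS ord0) = h' (ordS (ordS ord0))
          & h (ordS (ordS ord0)) = h' ord0]
   | [/\ h ord0 = h' (ordS (ordS ord0)), h (ordS ord0) = h' ord0
          & h (ordS (ordS ord0)) = h' (ordS ord0)]].
  by case=> -[h0 h1 h2]; [exists 0 | exists 1 | exists 2]; apply: ord3_ind;
     rewrite /= ?ordS3.
move: eq_h.
by case: (h ord0) (h (ordS ord0)) (h (ordS (ordS ord0))) => [] [] [];
   case: (h' ord0) (h' (ordS ord0)) (h' (ordS (ordS ord0))) => [] [] [] // _;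
   solve [constructor 1 => // | constructor 2 => // | constructor 3 => //].
Qed.

(** * Labelings and automorphisms of a triangle of copies *)

Section Tertians.

Variable T : tournament.
Implicit Types (phi psi : {ffun triangle T -> bool}) (s : {perm triangle T}).

Definition tertian_labeling phi (i : 'I_3) : {ffun T -> bool} :=
  [ffun u => phi (i, u)].

(** A rotation of the cyclic triangle, together with an automorphism of [T] for
    each copy, is an automorphism of the triangle of copies: the arcs between
    copies depend only on the cyclic order. *)
Lemma triangle_automorphism n (g : 'I_3 -> {perm T}) :
    (forall i, g i \in automorphisms T) ->
  exists2 s, s \in automorphisms (triangle T) &
    forall i u, s (i, u) = (iter n (@ordS 3) i, g i u).
Proof.
move=> gA; pose r := iter n (@ordS 3).
have r_inj : injective r.
  by rewrite {}/r; elim: n => [|n IHn] i j //= /ordS_inj /IHn.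
have rS i : r (ordS i) = ordS (r i) by rewrite /r -iterSr.
pose f (p : triangle T) : triangle T := (r p.1, g p.1 p.2).
have f_inj : injective f.
  by move=> [i u] [j v] [/r_inj -> /perm_inj ->].
exists (perm f_inj) => [|i u]; last by rewrite permE.
apply/automorphismsP => -[i u] [j v]; rewrite !permE /f /= /arc3 /=.
rewrite (inj_eq r_inj); have [-> | _] := eqVneq i j.
  exact/automorphismsP.
by rewrite -rS (inj_eq r_inj).
Qed.

(** An automorphism of one tertian extends by the identity on the two others. *)
Lemma tertian_distinguishing phi i :
  distinguishing phi -> distinguishing (tertian_labeling phi i).
Proof.
move=> /distinguishingP dphi; apply/distinguishingP => s sA sphi.
have [|t tA tE] := @triangle_automorphism 0 (fun j => if j == i then s else 1%g).
  by move=> j; case: eqP => // _; apply/automorphismsP => u v; rewrite !perm1.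
have t1 : t = 1%g.
  apply: dphi => // -[j u]; rewrite tE /=; case: eqP => [-> | _].
    by have := sphi u; rewrite !ffunE.
  by rewrite perm1.
by apply/permP => u; have := tE i u; rewrite t1 eqxx !perm1 => -[].
Qed.

Lemma rotated_labelings n phi psi :
    (forall i, isomorphic_labelings (tertian_labeling phi i)
                 (tertian_labeling psi (iter n (@ordS 3) i))) ->
  exists2 s, s \in automorphisms (triangle T) &
    (forall p, psi (s p) = phi p) /\ forall p, (s p).1 = iter n (@ordS 3) p.1.
Proof.
move=> /fin_all_exists2[g gA gE].
have [s sA sE] := triangle_automorphism n gA.
exists s => //; split=> -[i u]; rewrite sE //.
by have := gE i u; rewrite !ffunE.
Qed.

Lemma weight_triangle phi :
  weight phi = \sum_(i < 3) weight (tertian_labeling phi i).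
Proof.
rewrite weight_sum; under [RHS]eq_bigr do rewrite weight_sum.
rewrite (pair_bigA _ (fun i u => tertian_labeling phi i u : nat)).
by apply: eq_bigr => -[i u] _; rewrite ffunE.
Qed.

(** The inductive step. Not all three tertians are equally heavy, since
    otherwise a rotation by one step would lift to a label-preserving
    automorphism; and the number of heavy tertians, hence their cyclic
    arrangement, can be read off from the total weight. *)
Lemma triangle_two_weights m :
  0 < #|T| -> two_weights T m -> two_weights (triangle T) (3 * m).+1.
Proof.
move=> T_gt0 [wT isoT].
(* For a distinguishing [phi], the weight on tertian [i] is [m + heavy phi i],
   so [heavy] determines the restriction up to isomorphism. *)
pose heavy phi i := weight (tertian_labeling phi i) == m.+1.
have wE phi i : distinguishing phi ->
    weight (tertian_labeling phi i) = m + heavy phi i.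
  move=> /(tertian_distinguishing i)/wT; rewrite /heavy => -[] ->.
    by rewrite (ltn_eqF (ltnSn m)) addn0.
  by rewrite eqxx addn1.
have iso phi psi i j : distinguishing phi -> distinguishing psi ->
    heavy phi i = heavy psi j ->
    isomorphic_labelings (tertian_labeling phi i) (tertian_labeling psi j).
  by move=> dphi dpsi hij; apply: isoT; rewrite ?wE ?hij //;
     apply: tertian_distinguishing.
have wsum phi : distinguishing phi -> weight phi =
    3 * m + (heavy phi ord0 + heavy phi (ordS ord0)
             + heavy phi (ordS (ordS ord0))).
  move=> dphi; rewrite weight_triangle.
  under eq_bigr do rewrite wE //.
  rewrite big_split /= sum_nat_const card_ord; congr (_ + _).
  rewrite !big_ord_recl big_ord0 addn0 addnA.
  by congr (_ + heavy phi _ + heavy phi _); apply: val_inj.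
have mixed phi : distinguishing phi ->
    ~~ ((heavy phi ord0 == heavy phi (ordS ord0))
        && (heavy phi (ordS ord0) == heavy phi (ordS (ordS ord0)))).
  move=> dphi; apply/negP => /andP[/eqP h01 /eqP h12].
  have [|s sA [sphi sE]] := @rotated_labelings 1 phi phi.
    apply: ord3_ind => /=; rewrite ?ordS3; apply: iso => //.
    by rewrite -h12 -h01.
  have /card_gt0P[x _] := T_gt0.
  have /distinguishingP/(_ s sA sphi) s1 := dphi.
  by have := sE (ord0, x); rewrite s1 perm1.
split=> [phi dphi | phi psi dphi dpsi].
  rewrite wsum //; move: (mixed _ dphi).
  case: (heavy phi ord0) (heavy phi (ordS ord0)) (heavy phi (ordS (ordS ord0)))
    => [] [] [] //= _; rewrite ?add0n ?addn0 ?addn1 ?addn2; by [left | right].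
rewrite !wsum // => /addnI eq_h.
have [n hn] := bool3_rotation eq_h.
have [|s sA [sE _]] := @rotated_labelings n phi psi; last by exists s.
by move=> i; apply: iso.
Qed.

(** Tertians are modules: a vertex outside of one cannot tell its elements
    apart, and this passes to their images. A module that meets two tertians
    contains the third one, whose vertices tell those two apart; it then meets
    any two tertians and contains everything. So the image of a tertian, which
    is not everything, lies within a single tertian. *)
Lemma automorphism_tertian s i u v : s \in automorphisms (triangle T) ->
  (s (i, u)).1 = (s (i, v)).1.
Proof.
move=> /automorphismsP sA.
(* If [s (i, x)] and [s (i, y)] lie in two tertians, the image of tertian
   [i] contains the third. *)
have inside x y w : (s (i, x)).1 != (s (i, y)).1 ->
    (s w).1 != (s (i, x)).1 -> (s w).1 != (s (i, y)).1 -> w.1 = i.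
  move=> nxy nwx nwy; apply/eqP/negPn/negP => nwi.
  have : arc w (i, x) = arc w (i, y).
    by rewrite /= /arc3 /= (negPf nwi).
  rewrite -(sA w (i, x)) -(sA w (i, y)) /= /arc3 (negPf nwx) (negPf nwy).
  case: (s (i, x)).1 (s (i, y)).1 (s w).1 nxy nwx nwy
    => [[|[|[|?]]] ?] [[|[|[|?]]] ?] [[|[|[|?]]] ?] //.
apply/eqP/negPn/negP => nuv.
have [c nuc nvc] : exists2 c : 'I_3, c != (s (i, u)).1 & c != (s (i, v)).1.
  have /card_gt0P[c] : 0 < #|~: [set (s (i, u)).1; (s (i, v)).1]|.
    by rewrite cardsCs setCK card_ord cards2; case: (_ != _).
  by rewrite !inE negb_or => /andP[]; exists c.
have [x sx] : exists x, (s (i, x)).1 = c.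
  have E : s (s^-1 (c, u))%g = (c, u) by rewrite permKV.
  move: E (inside u v (s^-1 (c, u))%g nuv); case: (s^-1 _)%g => j x E.
  rewrite E => /(_ nuc nvc) /= ij; by exists x; rewrite -ij E.
have all_i (w : triangle T) : w.1 = i.
  have [wu | nwu] := eqVneq (s w).1 (s (i, u)).1.
    by apply: (inside v x); rewrite ?sx ?wu // eq_sym.
  have [wv | nwv] := eqVneq (s w).1 (s (i, v)).1.
    by apply: (inside u x); rewrite ?sx ?wv // eq_sym.
  exact: (inside u v).
have := all_i (ordS i, u); move=> /=.
by case: i {inside nuv nuc nvc sx all_i} => [[|[|[|?]]] ?].
Qed.

(** Complementing the labels on one tertian breaks the rotational symmetry: for
    [T] of odd order, no bijection of [T] exchanges the two labels. *)
Lemma triangle_distinguishing (phi : {ffun T -> bool}) :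
    odd #|T| -> distinguishing phi ->
  distinguishing [ffun p : triangle T => phi p.2 (+) (p.1 == ord0)].
Proof.
move=> oddT /distinguishingP dphi; apply/distinguishingP => s sA sphi.
have [x _] : exists x, x \in T by apply/card_gt0P; apply: odd_gt0.
(* [s] acts by [f] on the tertians, and by [g i] within tertian [i]. *)
pose f i := (s (i, x)).1; pose g i u := (s (i, u)).2.
have sE i u : s (i, u) = (f i, g i u).
  by rewrite [LHS]surjective_pairing (@automorphism_tertian s i u x).
have f_inj : injective f.
  apply: (can_inj (g := fun j => (s^-1 (j, x))%g.1)); apply: canF_sym => j.
  have := permKV s (j, x); case: (s^-1 _)%g => i u.
  by rewrite sE => -[].
have g_inj i : injective (g i).
  move=> u v guv; have /perm_inj[//] : s (i, u) = s (i, v).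
  by rewrite !sE guv.
have nS (i : 'I_3) : i != ordS i by case: i => [[|[|[|?]]] ?].
have fS i : f (ordS i) = ordS (f i).
  have /automorphismsP/(_ (i, x) (ordS i, x)) := sA.
  by rewrite !sE /= /arc3 /= (inj_eq f_inj) (negPf (nS i)) eqxx => /eqP.
(* Otherwise [g ord0] would match the vertices of [T] labeled [true] with
   those labeled [false]. *)
have f0 : f ord0 = ord0.
  apply/eqP/negPn/negP => nf0.
  have swap u : phi (g ord0 u) = ~~ phi u.
    by have := sphi (ord0, u); rewrite !ffunE sE /= (negPf nf0) addbF addbT.
  move: oddT; rewrite -(cardsC [set u | phi u]).
  rewrite -(_ : g ord0 @^-1: [set u | phi u] = ~: [set u | phi u]).
    by rewrite card_preimset // addnn odd_double.
  by apply/setP => u; rewrite !inE swap.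
have fid i : f i = i.
  have -> : i = iter i (@ordS 3) ord0.
    by case: i => [[|[|[|?]]] ?] //; apply: val_inj.
  by elim: (i : nat) => //= n IHn; rewrite fS IHn.
apply/permP => -[i u]; rewrite perm1 sE fid; congr (_, _).
have -> : g i u = perm (@g_inj i) u by rewrite permE.
rewrite (dphi (perm (@g_inj i))) ?perm1 //.
  apply/automorphismsP => v w; rewrite !permE.
  have /automorphismsP/(_ (i, v) (i, w)) := sA.
  by rewrite !sE /= /arc3 /= !eqxx.
move=> v; rewrite permE; have := sphi (i, v).
by rewrite !ffunE sE fid /= => /addIb.
Qed.

End Tertians.

(** * The tournaments H_k *)

Lemma half_exp3 k : 3 ^ k = (3 ^ k %/ 2).*2.+1.
Proof. by rewrite -[LHS]odd_double_half oddX orbT divn2. Qed.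

Lemma H_two_weights k : two_weights (H k) (3 ^ k %/ 2).
Proof.
elim: k => [|k IHk]; first exact: point_two_weights.
have -> : 3 ^ k.+1 %/ 2 = (3 * (3 ^ k %/ 2)).+1.
  by rewrite expnS [in LHS]half_exp3 -muln2 divn2; lia.
by apply: triangle_two_weights; rewrite // card_H expn_gt0.
Qed.

Lemma H_distinguishing k : exists phi : {ffun H k -> bool}, distinguishing phi.
Proof.
elim: k => [|k [phi dphi]].
  exists [ffun=> false]; apply/distinguishingP => s _ _.
  by apply/permP => -[]; case: (s _) => //; rewrite perm1.
exists [ffun p : H k.+1 => phi p.2 (+) (p.1 == ord0)].
by apply: triangle_distinguishing; rewrite // card_H oddX orbT.
Qed.

Theorem proposition2 (k : nat) : 3 ^ k %/ 2 <= rho (H k).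
Proof.
have [phi dphi] := H_distinguishing k.
have [|[A dA <-] _] := @rho_min (H k) [set v | phi v == true].
  by apply/existsP; exists phi; apply/existsP; exists true; rewrite dphi eqxx.
have /existsP[psi /existsP[b /andP[dpsi /eqP ->]]] := dA.
have [wH _] := H_two_weights k.
rewrite card_label card_H.
by case: (wH _ dpsi) (half_exp3 k) => ->; case: b; lia.
Qed.
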